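(* Given an odometer system $(X,H_X)$, there exists a minimal homeomorphism of the Fraïssé fence which admits $H_X$ as a factor.
   Context: An odometer: for a sequence $p=(p_i)$ of positive integers with $p_i\mid p_{i+1}$ and $p_i<p_{i+1}$, $X=\varprojlim\mathbb{Z}/p_i\mathbb{Z}$ (bonding maps reduction mod $p_i$) and $H_X$ is addition of $1$ in every coordinate. Fences: for $\Phi=(\varphi^L,\varphi^U)$ with $\varphi^L,\varphi^U$ from a Cantor space $Y$ to $[0,1]$, $\varphi^L$ lower semicontinuous, $\varphi^U$ upper semicontinuous, $\varphi^L\le\varphi^U$, $\mathbf{F}_\Phi=\{(y,t):\varphi^L(y)\le t\le\varphi^U(y)\}$ and $\mathbf{F}_\Phi(y)=\{t:(y,t)\in\mathbf{F}_\Phi\}$. $\mathbf{F}_\Phi$ is a Fraïssé fence if for every $y$ and every continuum $I\subseteq\mathbf{F}_\Phi(y)$ there is a sequence $y_k\ne y$, $y_k\to y$, with each $\mathbf{F}_\Phi(y_k)$ a nondegenerate arc and $\mathbf{F}_\Phi(y_k)\to I$ in the Hausdorff metric; all Fraïssé fences are homeomorphic, and ''the Fraïssé fence'' refers to this space. A homeomorphism is minimal if every orbit is dense; $H_X$ is a factor of $T$ if there is a continuous surjection $\pi$ with $\pi\circ T=H_X\circ\pi$. *)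

(* Defs.v *)
From HB Require Import structures.
From mathcomp Require Import all_boot all_order all_algebra.
From mathcomp Require Import all_classical all_reals all_analysis.
Set Implicit Arguments. Unset Strict Implicit. Unset Printing Implicit Defensive.
Import Order.TTheory GRing.Theory Num.Theory.
Import numFieldNormedType.Exports.
Local Open Scope classical_set_scope.
Local Open Scope ring_scope.

Definition odometer_seq (p : nat -> nat) : Prop :=
  forall i, (0 < p i)%N /\ (p i %| p i.+1)%N /\ (p i < p i.+1)%N.

Definition natseq : Type := prod_topology (fun _ : nat => nat).

(* X = inverse limit of Z/p_i Z, bonding maps = reduction mod p_i *)
Definition odometer_space (p : nat -> nat) : set natseq :=
  [set x | forall i, (x i < p i)%N /\ x i = (x i.+1 %% p i)%N].

Definition odometer_map (p : nat -> nat) (x : natseq) : natseq :=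
  fun i => ((x i).+1 %% p i)%N.

Section Fence.
Context {R : realType}.

Definition lsc (f : cantor_space -> R) : Prop :=
  forall y (a : R), a < f y -> exists2 V, nbhs y V & forall z, V z -> a < f z.

Definition usc (f : cantor_space -> R) : Prop :=
  forall y (a : R), f y < a -> exists2 V, nbhs y V & forall z, V z -> f z < a.

Definition fence_pair (phiL phiU : cantor_space -> R) : Prop :=
  [/\ forall y, 0 <= phiL y <= 1, forall y, 0 <= phiU y <= 1,
      lsc phiL, usc phiU & forall y, phiL y <= phiU y].

Definition fence (phiL phiU : cantor_space -> R) : set (cantor_space * R) :=
  [set z | phiL z.1 <= z.2 <= phiU z.1].

Definition fiber (phiL phiU : cantor_space -> R) (y : cantor_space) : set R :=
  [set t | fence phiL phiU (y, t)].

Definition continuum (I : set R) : Prop :=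
  [/\ I !=set0, compact I & connected I].

Definition hausdorff_cvg (A : nat -> set R) (I : set R) : Prop :=
  forall e : R, 0 < e -> \forall k \near \oo,
    (forall a, A k a -> exists2 b, I b & `|a - b| < e) /\
    (forall b, I b -> exists2 a, A k a & `|a - b| < e).

Definition fraisse_fence (phiL phiU : cantor_space -> R) : Prop :=
  fence_pair phiL phiU /\
  forall y (I : set R), continuum I -> I `<=` fiber phiL phiU y ->
    exists yk : nat -> cantor_space,
      [/\ forall k, yk k <> y,
          (yk @ \oo --> y),
          forall k, phiL (yk k) < phiU (yk k)
        & hausdorff_cvg (fun k => fiber phiL phiU (yk k)) I].
End Fence.

Definition homeomorphism_on {T : topologicalType} (A : set T) (f : T -> T) :=
  exists g : T -> T,
    [/\ forall x, A x -> A (f x), forall x, A x -> A (g x),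
        forall x, A x -> g (f x) = x, forall x, A x -> f (g x) = x
      & {within A, continuous f} /\ {within A, continuous g}].

(* full (Z-)orbit of x under f, f being a bijection of A *)
Definition orbit_on {T : Type} (f : T -> T) (x : T) : set T :=
  [set y | exists n : nat, y = iter n f x \/ iter n f y = x].

Definition minimal_on {T : topologicalType} (A : set T) (f : T -> T) :=
  homeomorphism_on A f /\
  forall x, A x -> A `<=` closure (A `&` orbit_on f x).

Definition factor_of {T U : topologicalType} (A : set T) (f : T -> T)
    (B : set U) (h : U -> U) :=
  exists pi : T -> U,
    [/\ {within A, continuous pi}, pi @` A = B
      & forall x, A x -> pi (f x) = h (pi x)].

(* Main.v *)
Require Import Defs.
From HB Require Import structures.
From mathcomp Require Import all_boot all_order all_algebra.
From mathcomp Require Import all_classical all_reals all_analysis.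
From mathcomp Require Import zify ring lra.
Import Order.TTheory GRing.Theory Num.Theory.
Import numFieldNormedType.Exports.
Local Open Scope classical_set_scope.
Local Open Scope ring_scope.

(** The homeomorphism is built directly on the given fence in the form
    [T (y, t) = (S y, expR (lam y) * t + beta y)], with [S] conjugate to the
    odometer and [lam], [beta] continuous.  At stage [n] the Cantor space is cut
    into [q] clopen cells permuted cyclically, where [q] is a term of [p]; each
    cell has a representative whose fibre is the longest of the cell and contains
    all the other fibres of the cell up to [eps n], and [lam], [beta] are
    approximated by the affine maps between the fibres of successive
    representatives.  To pass from [q] to [q * r] cells, choose a slowly varying
    closed chain of [r] subintervals of [[0, 1]] starting from the whole of
    [[0, 1]], and ask the cell [i + q * j] to look, inside the fibre of the [i]-th
    old representative, like the [j]-th subinterval of the chain.  The chain visits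
    the relative positions of the pieces of a fine partition of the old cells, and
    the remaining cells are carved out near the old representatives by the Fraisse
    property.  As the chain varies slowly, the affine maps converge uniformly; as
    it also visits a fine grid of short subintervals, every orbit is dense. *)

(** * Cylinders and tight partitions of the Cantor space *)

Definition agree (n : nat) (y z : cantor_space) : Prop :=
  forall i, (i < n)%N -> y i = z i.

Lemma agree_refl n y : agree n y y. Proof. by []. Qed.

Lemma agree_sym n y z : agree n y z -> agree n z y.
Proof. by move=> h i ni; rewrite h. Qed.

Lemma agree_trans n x y z : agree n x y -> agree n y z -> agree n x z.
Proof. by move=> h k i ni; rewrite h// k. Qed.

Lemma agree_le m n y z : (m <= n)%N -> agree n y z -> agree m y z.
Proof. by move=> mn h i im; apply: h; apply: leq_trans mn. Qed.

Lemma agree_neq (y z : cantor_space) : z <> y -> exists n, ~ agree n z y.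
Proof.
move=> zy; apply: contrapT => /forallNP h; apply: zy; apply/funext => i.
by have /contrapT := h i.+1; apply.
Qed.

Lemma nbhs_coord (T : topologicalType) (x : prod_topology (fun _ : nat => T))
  i (V : set T) : nbhs (x i) V -> nbhs x [set z : prod_topology (fun _ => T) | V (z i)].
Proof. by move=> h; exact: (@proj_continuous nat (fun=> T) i x V h). Qed.

Lemma cvg_coord (T : topologicalType) (F : set_system (prod_topology (fun _ : nat => T)))
    (x : prod_topology (fun _ : nat => T)) : Filter F ->
  (forall i (V : set T), nbhs (x i) V ->
     F [set z : prod_topology (fun _ : nat => T) | V (z i)]) ->
  F --> x.
Proof.
move=> FF h; apply/cvg_sup => i U.
rewrite (@nbhsE (initial_topology (fun f : nat -> T => f i))).
case=> B [[C oC <-] Cx] BU; apply: (filterS BU).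
by apply: (h i C); apply: open_nbhs_nbhs; split.
Qed.

Lemma nbhs_agree (y : cantor_space) n : nbhs y (agree n y).
Proof.
elim: n => [|n IH]; first by apply: filterE.
have h : nbhs y [set z : cantor_space | y n = z n].
  apply: (@nbhs_coord bool y n [set b | y n = b]).
  by apply: (filterS _ (discrete_set1 (y n : bool))) => b ->.
have : nbhs y (agree n y `&` [set z : cantor_space | y n = z n]) by apply: filterI.
apply: filterS => z [az zn] i.
by rewrite ltnS leq_eqVlt => /orP[/eqP ->|] //; exact: az.
Qed.

(** The sets containing a cylinder around [y] form a filter converging to [y] coordinatewise, so it
    refines the neighbourhood filter of the product. *)
Lemma nbhs_cantorP (y : cantor_space) (V : set cantor_space) :
  nbhs y V <-> exists n, agree n y `<=` V.
Proof.
split; last by move=> [n nV]; apply: filterS nV (nbhs_agree y n).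
pose F : set_system cantor_space := [set W | exists n, agree n y `<=` W].
have FF : Filter F.
  split; first by exists 0%N.
    move=> P Q [m mP] [n nQ]; exists (maxn m n) => z az; split.
      by apply: mP; apply: agree_le az; exact: leq_maxl.
    by apply: nQ; apply: agree_le az; exact: leq_maxr.
  by move=> P Q PQ [n nP]; exists n; apply: subset_trans PQ.
have : F --> y.
  apply: (@cvg_coord bool) => i W Wy; exists i.+1 => z az.
  by rewrite /mkset -(az i) //; exact: nbhs_singleton Wy.
by apply.
Qed.

(** Compactness as an induction principle: if [P setT] failed, the complements of the sets
    satisfying [P] would form a proper filter, and a cluster point would contradict the local
    hypothesis. *)
Lemma cantor_induction (P : set cantor_space -> Prop) :
  (forall A B, A `<=` B -> P B -> P A) -> P set0 ->
  (forall A B, P A -> P B -> P (A `|` B)) ->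
  (forall y, exists n, P (agree n y)) -> P setT.
Proof.
move=> Psub P0 PU Ploc; apply: contrapT => nPT.
pose F : set_system cantor_space := [set A | P (~` A)].
have FF : ProperFilter F.
  split; first by rewrite /F /= setC0.
  split; first by rewrite /F /= setCT.
    by move=> A B FA FB; rewrite /F /= setCI; exact: PU.
  by move=> A B AB; apply: Psub; exact: subsetC.
have [y [_ cy]] := @cantor_space_compact F FF filterT.
have [n Pn] := Ploc y.
have : F (~` agree n y) by rewrite /F /= setCK.
by move=> /cy/(_ (nbhs_agree y n)) [z []].
Qed.

(** A clopen partition is encoded by the labels of its cells. *)
Definition locally_constant (c : cantor_space -> nat) : Prop :=
  forall y, exists n, forall z, agree n y z -> c z = c y.

Lemma locally_constant_bounded c : locally_constant c -> exists B, forall y, (c y < B)%N.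
Proof.
move=> lc; have [||||B] := @cantor_induction (fun A => exists B, forall y, A y -> (c y < B)%N).
- by move=> A A' AA' [B hB]; exists B => y /AA'/hB.
- by exists 0%N.
- move=> A A' [B hB] [B' hB']; exists (maxn B B') => y [/hB|/hB'] h.
    by rewrite (leq_trans h)// leq_maxl.
  by rewrite (leq_trans h)// leq_maxr.
- by move=> y; have [n hn] := lc y; exists n, (c y).+1 => z /hn ->.
by move=> hB; exists B => y; exact: hB.
Qed.

(** * Fibres of a Fraisse fence over small cells *)

Section Fences.
Context {R : realType}.
Variables L U : cantor_space -> R.
Hypothesis FF : fraisse_fence L U.

Lemma fence_ge0 y : 0 <= L y. Proof. by have [[h _ _ _ _] _] := FF; have /andP[] := h y. Qed.
Lemma fence_le1 y : U y <= 1. Proof. by have [[_ h _ _ _] _] := FF; have /andP[] := h y. Qed.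
Lemma fence_le y : L y <= U y. Proof. by have [[_ _ _ _ h] _] := FF. Qed.

Definition len y := U y - L y.

Lemma len_ge0 y : 0 <= len y. Proof. by rewrite subr_ge0 fence_le. Qed.

Lemma len_le1 y : len y <= 1.
Proof. by have := fence_ge0 y; have := fence_le1 y; rewrite /len; lra. Qed.

Lemma fence_semicontinuous y (e : R) : 0 < e ->
  exists n, forall z, agree n y z -> L y - e < L z /\ U z < U y + e.
Proof.
move=> e0; have [[_ _ lL uU _] _] := FF.
have [|V /nbhs_cantorP[n nV] hV] := lL y (L y - e); first by rewrite ltrBlDr ltrDl.
have [|W /nbhs_cantorP[m mW] hW] := uU y (U y + e); first by rewrite ltrDl.
exists (maxn n m) => z az; split.
  by apply/hV/nV; apply: agree_le az; exact: leq_maxl.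
by apply/hW/mW; apply: agree_le az; exact: leq_maxr.
Qed.

(** The Fraisse property is applied to the continuum [[a, b]]. Hausdorff-close intervals have close
    endpoints: test the endpoints of each against the other. *)
Lemma fraisse_approx y a b (e : R) n : L y <= a -> a <= b -> b <= U y -> 0 < e ->
  exists z, [/\ z <> y, agree n y z, L z < U z, `|L z - a| < e & `|U z - b| < e].
Proof.
move=> La ab bU e0; have [_ /(_ y `[a, b]%classic)[]] := FF.
- split; [|exact: segment_compact|exact: segment_connected].
  by exists a; rewrite /= in_itv /= lexx.
- move=> t; rewrite /= in_itv /= => /andP[at_ tb].
  by rewrite /fiber /fence /= (le_trans La at_) (le_trans tb bU).
move=> yk [neq cvg nondeg /(_ _ e0) haus].
have near1 : \forall k \near \oo, agree n y (yk k) by exact: (cvg _ (nbhs_agree y n)).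
have [k [[h1 h2] hk]] := filter_ex (filterI haus near1).
exists (yk k).
have Lk : fiber L U (yk k) (L (yk k)) by rewrite /fiber /fence /= lexx fence_le.
have Uk : fiber L U (yk k) (U (yk k)) by rewrite /fiber /fence /= lexx fence_le.
split => //.
  have [s] := h1 _ Lk; rewrite /= in_itv /= => /andP[as_ _] /ltr_normlP[h3 h3'].
  have [|s' ] := h2 a; first by rewrite /= in_itv /= lexx.
  rewrite /fiber /fence /= => /andP[Ls' _] /ltr_normlP[h5 h4].
  by rewrite ltr_norml; apply/andP; split; lra.
have [s] := h1 _ Uk; rewrite /= in_itv /= => /andP[_ sb] /ltr_normlP[h3 h3'].
have [|s' ] := h2 b; first by rewrite /= in_itv /= lexx ab.
rewrite /fiber /fence /= => /andP[_ Ls'] /ltr_normlP[h5 h4].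
by rewrite ltr_norml; apply/andP; split; lra.
Qed.

Lemma nondegenerate_dense y n : exists2 z, agree n y z & 0 < len z.
Proof.
have [z [_ az h _ _]] := @fraisse_approx y (L y) (L y) 1 n (lexx _) (lexx _) (fence_le y) ltr01.
by exists z => //; rewrite subr_gt0.
Qed.

Definition longest (C : set cantor_space) z := C z /\ forall w, C w -> len w <= len z.

(** [len] is upper semicontinuous. Without a maximum, the cell is covered by cylinders each beaten
    by one fibre of the cell, and [cantor_induction] gives a fibre longer than itself. *)
Lemma longest_exists c y : locally_constant c -> exists z, longest [set w | c w = c y] z.
Proof.
move=> lc; apply: contrapT => /forallNP nomax.
pose P (A : set cantor_space) :=
  exists z, c z = c y /\ forall w, A w -> c w = c y -> len w < len z.
have [||||z [cz /(_ z I cz)]] := @cantor_induction P; last by rewrite ltxx.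
- by move=> A B AB [z [cz h]]; exists z; split => // w /AB; exact: h.
- by exists y.
- move=> A B [z [cz hz]] [z' [cz' hz']].
  have [zz'|/ltW zz'] := leP (len z) (len z').
    by exists z'; split => // w [/hz h /h|/hz' h /h] // /lt_le_trans; exact.
  by exists z; split => // w [/hz h /h|/hz' h /h] // /lt_le_trans; exact.
move=> x; have [cx|cx] := pselect (c x = c y); last first.
  by have [n hn] := lc x; exists n, y; split => // w /hn -> /cx.
have [z [cz xz]] : exists z, c z = c y /\ len x < len z.
  apply: contrapT => /forallNP h; apply: (nomax x); split => // w cw.
  by rewrite leNgt; apply/negP => xw; apply: (h w).
have [|n hn] := @fence_semicontinuous x ((len z - len x) / 2); first by lra.
by exists n, z; split => // w /hn[h1 h2] _; move: xz h1 h2; rewrite /len; lra.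
Qed.

Definition tight (C : set cantor_space) (d : R) := forall z w,
  longest C z -> C w -> L z - d <= L w /\ U w <= U z + d.

(** Nearby fibres stick out of the fibre of [y] by at most [d / 2]; a longest one is also no shorter
    than that fibre, so both its endpoints are within [d / 2]. *)
Lemma tight_cylinder y (d : R) : 0 < d ->
  exists n0, forall n, (n0 <= n)%N -> tight (agree n y) d /\
  (forall z, longest (agree n y) z -> `|L z - L y| <= d /\ `|U z - U y| <= d).
Proof.
move=> d0; have [|n0 h0] := @fence_semicontinuous y (d / 2); first by lra.
exists n0 => n nn; have h z (az : agree n y z) := h0 z (agree_le _ _ _ _ nn az).
split.
  move=> z w [az mz] aw; have := mz y (agree_refl _ _); rewrite /len.
  by have [] := h z az; have [] := h w aw; lra.
move=> z [az mz]; have := mz y (agree_refl _ _); rewrite /len.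
by have [] := h z az; move=> h1 h2 h3; rewrite !ler_norml; split; apply/andP; split; lra.
Qed.

(** Each point takes the shortest good cylinder around it. Goodness depends on the cylinder only, so
    these cylinders are equal or disjoint, and the encoded prefix labels them. *)
Lemma fine_partition c (d : R) N : locally_constant c -> 0 < d ->
  exists w : cantor_space -> nat, [/\ locally_constant w,
   (forall y z, w y = w z -> c y = c z /\ agree N y z) &
   forall y, tight [set z | w z = w y] d].
Proof.
move=> lc d0.
pose good n y := [/\ (N <= n)%N, (forall z, agree n y z -> c z = c y) & tight (agree n y) d].
have good_agree n y z : agree n y z -> good n y -> good n z.
  move=> yz [Nn cn tn].
  have E : agree n z = agree n y.
    apply/seteqP; split => w h; first exact: agree_trans yz h.
    exact: agree_trans (agree_sym _ _ _ yz) h.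
  split => //; last by rewrite E.
  by move=> w; rewrite E => /cn ->; rewrite (cn z).
have goodex y : exists n, `[< good n y >].
  have [m hm] := lc y; have [k hk] := tight_cylinder y d d0.
  exists (maxn N (maxn m k)); apply/asboolP; split; first exact: leq_maxl.
    by move=> z az; apply: hm; apply: agree_le az; lia.
  by apply: (hk _ _).1; lia.
pose nn y := ex_minn (goodex y).
have nnP y : good (nn y) y /\ forall m, good m y -> (nn y <= m)%N.
  rewrite /nn; case: ex_minnP => m /asboolP gm h; split => // k /asboolP; exact: h.
have nnE y z : agree (nn y) y z -> nn z = nn y.
  move=> yz; apply/eqP; rewrite eqn_leq; have zle : (nn z <= nn y)%N.
    by apply: (nnP z).2; apply: good_agree yz (nnP y).1.
  rewrite zle /=; apply: (nnP y).2.
  by apply: (good_agree _ z) (nnP z).1; apply/agree_sym/(agree_le _ _ _ _ zle).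
pose w y := pickle (mkseq y (nn y)).
have wP y z : w y = w z <-> agree (nn y) y z.
  split.
    move/(pcan_inj pickleK) => E; have := congr1 size E; rewrite !size_mkseq => En i iy.
    by have := congr1 (nth false ^~ i) E; rewrite !nth_mkseq // -En.
  move=> yz; rewrite /w (nnE _ _ yz); congr pickle; apply/eq_in_map => i.
  by rewrite mem_iota /= => /yz.
exists w; split.
- by move=> y; exists (nn y) => z /wP.
- move=> y z /wP yz; have [[Nn cn _] _] := nnP y.
  by split; [rewrite (cn z)|exact: agree_le yz].
- move=> y; have [[_ _ tn] _] := nnP y.
  rewrite (_ : [set z | w z = w y] = agree (nn y) y) //.
  by apply/seteqP; split => z /=; [move=> /esym/wP|move=> /wP ->].
Qed.

Lemma ln_near (x e : R) : 0 < x -> 0 < e ->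
  exists2 h, 0 < h & forall x', `|x' - x| <= h -> 0 < x' /\ `|ln x' - ln x| <= e.
Proof.
move=> x0 e0; have /cvgrPdist_le /(_ _ e0) /nbhs_ballP[r /= r0 hr] := continuous_ln x0.
exists (Num.min (r / 2) (x / 2)); first by rewrite lt_min !divr_gt0.
move=> x'; rewrite le_min => /andP[h1 h2]; split.
  by move: h2; rewrite ler_norml => /andP[]; lra.
rewrite distrC; apply: hr; rewrite /ball /= distrC; lra.
Qed.

(** This supplies the cells missing from a refinement: a subinterval of the fibre of [y] is imitated
    by a cylinder close to [y] that avoids [y]. *)
Lemma carve y a b (d : R) N : L y <= a -> a < b -> b <= U y -> 0 < d ->
  exists z n, [/\ agree N y z, ~ agree n z y, (N <= n)%N & exists2 z',
     longest (agree n z) z' & [/\ tight (agree n z) d, `|L z' - a| <= d,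
      0 < len z' & `|ln (len z') - ln (b - a)| <= d]].
Proof.
move=> La ab bU d0.
have [|h h0 hP] := @ln_near (b - a) d _ d0; first by lra.
(* Errors from [z'] to [z] and from [z] to the target add up: [4 * e <= h] controls the length,
   [2 * e <= d] the lower endpoint. *)
pose e := Num.min (h / 4) (d / 2).
have e0 : 0 < e by rewrite lt_min; apply/andP; split; lra.
have eh : e <= h / 4 by rewrite /e ge_min lexx.
have ed : e <= d / 2 by rewrite /e ge_min lexx orbT.
have [z [zy yz nz hL hU]] := @fraisse_approx y a b e N La (ltW ab) bU e0.
have [m hm] := agree_neq _ _ zy.
have [k hk] := tight_cylinder z e e0.
exists z, (maxn N (maxn m k)); split => //.
- by move=> /agree_le h'; apply: hm; apply: h'; lia.
- exact: leq_maxl.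
have [|tn ln_] := hk (maxn N (maxn m k)); first by lia.
(* The cylinder becomes a cell of a two-valued labelling, so that [longest_exists] applies. *)
pose g w : nat := ~~ `[< agree (maxn N (maxn m k)) z w >].
have gE : [set w | g w = g z] = agree (maxn N (maxn m k)) z.
  apply/seteqP; split => w; rewrite /g /=.
    by rewrite (asboolT (agree_refl _ z)); case: asboolP.
  by move=> /asboolT ->; rewrite (asboolT (agree_refl _ z)).
have [|z'] := @longest_exists g z.
  move=> w; exists (maxn N (maxn m k)) => w' ww'; rewrite /g; congr (nat_of_bool (~~ _)).
  apply: asbool_equiv_eq; split => h'; last exact: agree_trans ww'.
  exact: agree_trans (agree_sym _ _ _ ww').
rewrite gE => lz'; exists z' => //; have [h1 h2] := ln_ _ lz'.
have hlen : `|len z' - (b - a)| <= h.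
  rewrite /len; move: h1 h2 hL hU; rewrite !ler_norml !ltr_norml.
  move=> /andP[? ?] /andP[? ?] /andP[? ?] /andP[? ?]; apply/andP; split; lra.
have [? ?] := hP _ hlen; split => //.
  by move=> u v lu av; have [] := tn u v lu av; lra.
move: h1 hL; rewrite !ler_norml !ltr_norml => /andP[? ?] /andP[? ?].
by apply/andP; split; lra.
Qed.

End Fences.

(** * Chains of subintervals *)

Section Chains.
Context {R : realType}.

(* [(u, v)] encodes the subinterval [[u, u + exp v]] of [[0, 1]]. *)
Definition subinterval (x : R * R) : Prop := 0 <= x.1 /\ x.1 + expR x.2 <= 1.

(** Scaling contracts towards [(0, 0)], the whole interval. By convexity
    [expR (s * v) <= (1 - s) + s * expR v], obtained here from the tangent line at [s * v]. *)
Lemma subinterval_scale (s u v : R) : 0 <= s <= 1 ->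
  subinterval (u, v) -> subinterval (s * u, s * v).
Proof.
move=> /andP[s0 s1] [/= u0 uv1]; split; rewrite /= ?mulr_ge0//.
have f0 := expR_gt0 (s * v); set f := expR _ in f0 *.
have h1 : f * (1 - s * v) <= 1.
  have := expR_ge1Dx (- (s * v)); rewrite expRN -/f => h.
  by rewrite -[leRHS](divff (lt0r_neq0 f0)) ler_pM2l.
have h2 : f * (1 + (1 - s) * v) <= expR v.
  have -> : expR v = f * expR ((1 - s) * v) by rewrite /f -expRD; congr expR; ring.
  by rewrite ler_pM2l // expR_ge1Dx.
have : f <= (1 - s) + s * expR v.
  have -> : f = (1 - s) * (f * (1 - s * v)) + s * (f * (1 + (1 - s) * v)) by ring.
  by apply: lerD; [rewrite -{2}(mulr1 (1 - s)) ler_wpM2l // subr_ge0|rewrite ler_wpM2l].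
have := ler_wpM2l s0 uv1; lra.
Qed.

(** One excursion from 0 up to 1, reached at [o = n], and back to 0 at [o = n.*2]. *)
Definition tent n o : R := (minn o (n.*2 - o))%:R / n%:R.

Lemma tent_itv n o : (0 < n)%N -> 0 <= tent n o <= 1.
Proof.
move=> n0; rewrite /tent divr_ge0 //= ler_pdivrMr ?ltr0n // mul1r ler_nat.
by rewrite geq_min; lia.
Qed.

Lemma tent_step n o : (0 < n)%N -> `|tent n o.+1 - tent n o| <= n%:R^-1.
Proof.
move=> n0; rewrite /tent -mulrBl normrM [X in _ * X]ger0_norm ?invr_ge0 //.
rewrite -[leRHS]mul1r ler_wpM2r ?invr_ge0 //.
have : (minn o.+1 (n.*2 - o.+1) <= (minn o (n.*2 - o)).+1)%N by lia.
have : (minn o (n.*2 - o) <= (minn o.+1 (n.*2 - o.+1)).+1)%N by lia.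
rewrite -!(ler_nat R) -!natr1; set a := _%:R; set b := _%:R => h1 h2.
by rewrite ler_norml; apply/andP; split; lra.
Qed.

(* The chain makes a separate tour from the whole of [[0, 1]] to each target and
   back, so that [pos] is injective. *)
Lemma chain_through (k : nat) (t : nat -> R * R) (d : R) :
  (forall b, (b < k)%N -> subinterval (t b)) -> 0 < d ->
  exists r (s : nat -> R * R) (pos : nat -> nat),
  [/\ injective pos, (forall b, (b < k)%N -> (pos b < r)%N /\ s (pos b) = t b),
    s 0%N = (0, 0) /\ (forall j, (r <= j)%N -> s j = (0, 0)) &
    forall j, [/\ subinterval (s j), `|(s j.+1).1 - (s j).1| <= d
               & `|(s j.+1).2 - (s j).2| <= d]].
Proof.
move=> tD d0.
(* [B] dominates both coordinates of every target, so the steps of a tour are at most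
   [B / n <= d]. *)
pose B : R := \sum_(b < k) (`|(t b).1| + `|(t b).2|).
have tB b : (b < k)%N -> `|(t b).1| + `|(t b).2| <= B.
  move=> bk; rewrite /B (bigD1 (Ordinal bk)) //= lerDl.
  by apply: sumr_ge0 => i _; exact: addr_ge0.
have B0 : 0 <= B by apply: sumr_ge0 => i _; exact: addr_ge0.
pose n := (Num.truncn (B / d)).+1.
have nB : B / n%:R <= d.
  rewrite ler_pdivrMr ?ltr0n // mulrC -ler_pdivrMr //.
  by apply/ltW; rewrite /n truncnS_gt.
have n0 : (0 < n)%N by [].
(* The quotient selects the target and the remainder the point of its tour; after [k] tours the
   chain rests at the whole interval. *)
pose s j : R * R := if (j %/ n.*2 < k)%N then
  (tent n (j %% n.*2)%N * (t (j %/ n.*2)%N).1,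
   tent n (j %% n.*2)%N * (t (j %/ n.*2)%N).2) else (0, 0).
have nn0 : (0 < n.*2)%N by rewrite double_gt0.
have posE b : ((b * n.*2 + n) %/ n.*2 = b)%N.
  by rewrite divnMDl // divn_small ?addn0 // -addnn -addn1 leq_add.
have posM b : ((b * n.*2 + n) %% n.*2 = n)%N by rewrite modnMDl modn_small // -addnn -addn1 leq_add.
(* The [b]-th target is met at the peak of the [b]-th tour. *)
exists (k * n.*2)%N, s, (fun b => b * n.*2 + n)%N; split.
- by move=> a b /(congr1 (fun x => x %/ n.*2)%N); rewrite !posE.
- move=> b bk; split.
    apply: (@leq_trans (b * n.*2 + n.*2)); first by rewrite ltn_add2l -addnn -addn1 leq_add.
    by rewrite addnC -mulSn leq_mul2r bk orbT.
  rewrite /s posE bk posM /tent -addnn addnK minnn divff ?pnatr_eq0 // !mul1r.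
  by case: (t b).
- split; first by rewrite /s mod0n /tent min0n !mul0r; case: ifP.
  move=> j kj; rewrite /s ifF //; apply/negbTE; rewrite -leqNgt.
  by rewrite leq_divRL.
move=> j; split.
- rewrite /s; case: ifPn => [h|_]; last first.
    by split; rewrite /= ?add0r ?expR0.
  by apply: subinterval_scale (tent_itv _ _ n0) _; rewrite -surjective_pairing; exact: tD.
(* Either the step stays inside a tour, or it leaves its last point, at height [1 / n], for
   [(0, 0)]. *)
all: have [jn|jn] := ltnP (j %% n.*2)%N.+1 n.*2.
all: have := divn_eq j n.*2; set q := (j %/ _)%N; set o := (j %% _)%N => jE.
1,3: have -> : s j.+1 = if (q < k)%N then (tent n o.+1 * (t q).1, tent n o.+1 * (t q).2) else (0, 0) by
  rewrite /s jE -addnS divnMDl // modnMDl divn_small // modn_small // addn0.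
1,2: rewrite /s -/q -/o; case: ifPn => qk /=; last by rewrite subrr normr0 ltW.
1,2: rewrite -mulrBl normrM; apply: le_trans nB; rewrite mulrC.
1,2: apply: ler_pM (tent_step _ _ n0) => //; apply: le_trans (tB _ qk).
1: by rewrite lerDl.
1: by rewrite lerDr.
all: have oE : o = n.*2.-1 by have := ltn_pmod j nn0; rewrite -/o; move: jn; rewrite -/o; lia.
all: have sj1 : s j.+1 = (0, 0) by
  rewrite /s jE oE -addnS prednK // -mulSnr modnMl /tent min0n !mul0r; case: ifP.
all: rewrite sj1 /s -/q -/o; case: ifPn => qk /=; last by rewrite subrr normr0 ltW.
all: rewrite sub0r normrN normrM; apply: le_trans nB; rewrite mulrC.
all: have -> : tent n o = n%:R^-1 by rewrite /tent oE (_ : minn _ _ = 1%N) ?mul1r //; lia.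
all: apply: ler_pM => //; last by rewrite ger0_norm ?invr_ge0.
all: apply: le_trans (tB _ qk).
1: by rewrite lerDl.
by rewrite lerDr.
Qed.

End Chains.

(** * Refining a cyclic partition *)

Record stage := Stage {
  period : nat;
  code : cantor_space -> nat;
  rep : nat -> cantor_space }.

Section Refinement.
Context {R : realType}.
Variables L U : cantor_space -> R.
Hypothesis FF : fraisse_fence L U.
Local Notation len := (len L U).

Definition dominates (c : cantor_space -> nat) (d : R) k z :=
  [/\ c z = k, 0 < len z &
   forall y, c y = k -> [/\ len y <= len z, L z - d <= L y & U y <= U z + d]].

Definition stage_ok (e : R) (s : stage) := [/\ (0 < period s)%N,
  locally_constant (code s), (forall y, (code s y < period s)%N) &
  forall i, (i < period s)%N -> dominates (code s) e i (rep s i)].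

Section Step.
Variables (s : stage) (ch : nat -> R * R) (N r : nat) (e d : R).
Hypotheses (ok : stage_ok e s) (e0 : 0 <= e) (d0 : 0 < d).
Hypothesis ch_sub : forall j, subinterval (ch j).
Local Notation q := (period s).

(* The cell [k = i + q * j] should look like the subinterval [ch j], in
   coordinates relative to the fibre of [rep s i]. *)
Definition nominal_low k := L (rep s (k %% q)%N) + len (rep s (k %% q)%N) * (ch (k %/ q)%N).1.
Definition nominal_log k := ln (len (rep s (k %% q)%N)) + (ch (k %/ q)%N).2.

(** The extra tolerance [e] is for old fibres, which may stick out of the fibre of their
    representative by [e]; their length is not affected. *)
Definition placed c k z := [/\ dominates c d k z, `|L z - nominal_low k| <= e + d &
  `|ln (len z) - nominal_log k| <= d].

(** Labels below [q * r] may still be missing, so only those that occur need a witness. Old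
    representatives witness their own new cells, which lets cylinders near them be removed. *)
Definition partial_refinement c := [/\ locally_constant c,
  (forall y, (c y < q * r)%N /\ (c y %% q)%N = code s y),
  (forall y z, c y = c z -> agree N y z),
  (forall y, exists z, placed c (c y) z) &
  (forall i, (i < q)%N -> placed c (c (rep s i)) (rep s i))].

(* The new cell is carved out of the cell of [rep s (k %% q)], avoiding that
   point, which therefore remains a longest fibre of its cell. *)
Lemma insert_cell c k : partial_refinement c -> (k < q * r)%N ->
  exists c', [/\ partial_refinement c', (exists y, c' y = k) &
    forall y, exists y', c' y' = c y].
Proof.
move=> pc kqr; have [lc cq cN cz crep] := pc.
have [hit|/forallNP nhit] := pselect (exists y, c y = k).
  by exists c; split => // y; exists y.
have [q0 lcode codeq dom] := ok.
have iq : (k %% q < q)%N by rewrite ltn_mod.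
set y0 := rep s (k %% q)%N.
have [cy0 len0 _] := dom _ iq; rewrite -/y0 in cy0 len0.
have [n1 hn1] := lc y0.
have [u0 uv1] := ch_sub (k %/ q)%N.
have exp_nom : expR (nominal_log k) = len y0 * expR (ch (k %/ q)%N).2.
  by rewrite /nominal_log expRD lnK.
(* The depth [maxn N n1] keeps the cylinder inside the [c]-cell of [y0] and fine enough for [N]. *)
have [||||z [n [y0z zy0 Nn [z' lz' [tz Lz' lenz' lnz']]]]] := @carve R L U FF y0
    (nominal_low k) (nominal_low k + expR (nominal_log k)) d (maxn N n1).
- by rewrite /nominal_low -/y0 lerDl mulr_ge0 // ltW.
- by rewrite ltrDl expR_gt0.
- rewrite exp_nom /nominal_low -/y0 -addrA -mulrDr.
  by have := ler_wpM2l (ltW len0) uv1; rewrite mulr1 /len; lra.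
- by [].
rewrite addrAC subrr add0r expRK in lnz'.
have cyl y : agree n z y -> agree (maxn N n1) y0 y.
  by move=> zy; apply: agree_trans y0z _; apply: agree_le zy.
have cylc y : agree n z y -> c y = c y0.
  by move=> /cyl y0y; apply: hn1; apply: agree_le y0y; exact: leq_maxr.
pose c' y := if `[< agree n z y >] then k else c y.
have c'in y : agree n z y -> c' y = k by move=> h; rewrite /c' asboolT.
have c'out y : ~ agree n z y -> c' y = c y by move=> h; rewrite /c' asboolF.
have c'k y : c' y = k -> agree n z y.
  by move=> h; apply: contrapT => nz; apply: (nhit y); rewrite -h c'out.
have c'nk y : c' y <> k -> ~ agree n z y by move=> h /c'in.
have ck : (c y0 %% q)%N = (k %% q)%N by rewrite (cq y0).2.
have c'y0 : c' y0 = c y0 by rewrite c'out.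
(* Shrinking a cell weakens what domination demands, provided the witness survives. *)
have stay w : ~ agree n z w -> placed c (c w) w -> placed c' (c w) w.
  move=> nw [[_ lw dw] h1 h2]; split=> //; split=> //; first by rewrite c'out.
  move=> y c'y; apply: dw.
  by rewrite -c'y c'out //; apply: c'nk; rewrite c'y => /nhit.
have k'placed : placed c' k z'.
  have [az' mz'] := lz'; split; first split => //; first exact: c'in.
    by move=> y /c'k zy; split; [exact: mz'| |]; have [] := tz z' y lz' zy.
  - by apply: le_trans Lz' _; rewrite lerDr.
  - by [].
exists c'; split; last 2 first.
- by exists z'; apply: c'in; exact: lz'.1.
- move=> y; have [zy|zy] := pselect (agree n z y); last by exists y; exact: c'out.
  by exists y0; rewrite c'y0 cylc.
split.
- move=> y; have [m hm] := lc y; exists (maxn n m) => x yx.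
  have E : agree n z y <-> agree n z x.
    have yx' : agree n y x by apply: agree_le yx; exact: leq_maxl.
    by split => h; apply: agree_trans h _ => //; exact: agree_sym.
  rewrite /c' (asbool_equiv_eq E); case: ifP => // _.
  by apply: hm; apply: agree_le yx; exact: leq_maxr.
- move=> y; have [zy|zy] := pselect (agree n z y).
    by rewrite c'in //; split => //; rewrite -ck -(cq y).2 cylc.
  by rewrite c'out.
- move=> y x E; have [zy|zy] := pselect (agree n z y).
    apply: (@agree_le _ n); first by apply: leq_trans Nn; exact: leq_maxl.
    by apply: agree_trans (agree_sym _ _ _ zy) _; apply: c'k; rewrite -E c'in.
  apply: cN; rewrite -(c'out y) // E c'out //.
  by apply: c'nk; rewrite -E c'out.
- move=> y; have [zy|zy] := pselect (agree n z y); first by rewrite c'in //; exists z'.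
  (* The cell that lost the cylinder may have lost its witness as well; [y0] replaces it. *)
  rewrite c'out //; have [cyy0|cyy0] := pselect (c y = c y0).
    by exists y0; rewrite cyy0; apply: stay => //; apply: crep.
  have [w pw] := cz y; exists w; have [[cw _ _] _ _] := pw; rewrite -cw in pw *.
  by apply: stay => // /cylc; rewrite cw.
(* A representative inside the cylinder would lie in the cell of [y0], hence have its index and be
   [y0] itself, which is outside. *)
- move=> i iq'; have nzi : ~ agree n z (rep s i).
    move=> /[dup] /cylc E zi; apply: zy0.
    have [ci _ _] := dom _ iq'.
    by rewrite /y0 -ck -E (cq _).2 ci.
  by rewrite c'out //; apply: stay => //; apply: crep.
Qed.

Lemma complete_refinement c : partial_refinement c ->
  exists c', partial_refinement c' /\ forall k, (k < q * r)%N -> exists y, c' y = k.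
Proof.
move=> pc.
have : forall m, (m <= q * r)%N -> exists c', partial_refinement c' /\
    forall k, (k < m)%N -> exists y, c' y = k.
  elim=> [|m IH] mr; first by exists c.
  have [c1 [pc1 h1]] := IH (ltnW mr).
  have [c2 [pc2 h2 h3]] := insert_cell _ _ pc1 mr.
  exists c2; split => // k; rewrite ltnS leq_eqVlt => /orP[/eqP -> //|/h1[y <-]].
  exact: h3.
by move=> /(_ _ (leqnn _)).
Qed.

Lemma refined_stage c : partial_refinement c ->
  exists s', [/\ period s' = (q * r)%N,
    (0 < r)%N -> stage_ok d s', (forall y, (code s' y %% q)%N = code s y),
    (forall y z, code s' y = code s' z -> agree N y z) &
    forall k, (k < q * r)%N -> `|L (rep s' k) - nominal_low k| <= e + d /\
      `|ln (len (rep s' k)) - nominal_log k| <= d].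
Proof.
move=> /complete_refinement[c' [[lc cq cN cz _] hit]].
have /choice[x hx] : forall k, exists x, (k < q * r)%N -> placed c' k x.
  move=> k; have [kr|kr] := boolP (k < q * r)%N; last by exists (fun=> false).
  by have [y <-] := hit _ kr; have [z] := cz y; exists z.
exists (Stage (q * r) c' x); split => //=.
- move=> r0; have [q0 _ _ _] := ok; split => //=; first by rewrite muln_gt0 q0.
    by move=> y; exact: (cq y).1.
  by move=> i /hx[].
- by move=> y; exact: (cq y).2.
- by move=> k /hx[].
Qed.

End Step.

Lemma relative_position (y z : cantor_space) (e : R) : 0 < len y -> 0 < len z ->
  0 <= e -> len z <= len y -> L y - e <= L z -> U z <= U y + e ->
  exists t, [/\ subinterval t, `|L z - (L y + len y * t.1)| <= e &
    ln (len z) = ln (len y) + t.2].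
Proof.
move=> ly lz e0 zy h1 h2.
(* Clamping makes the interval fit inside the fibre of [y]; as [z] sticks out by at most [e], this
   moves the lower end by at most [e]. *)
pose u := Num.max 0 (Num.min (L z - L y) (len y - len z)).
exists (u / len y, ln (len z) - ln (len y)); split => /=.
- split => /=; first by rewrite divr_ge0 ?(ltW ly) // le_max lexx.
  rewrite expRB !lnK // -mulrDl ler_pdivrMr // mul1r /u.
  by case: (ltP (L z - L y)) => ?; case: (ltP 0) => ?; lra.
- rewrite mulrCA divff ?lt0r_neq0 // mulr1 /u ler_norml; move: h1 h2; rewrite /len in ly lz zy *.
  by case: (ltP (L z - L y)) => ?; case: (ltP 0) => ?; move=> *; apply/andP; split; lra.
- by rewrite addrC subrK.
Qed.

(** The chain has [M + G] targets: the relative positions of the cells of a fine partition [w],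
    which are then placed, and a grid of intervals of length [1 / G], for density. Carving supplies
    the remaining labels. Every large [r] works because the chain ends at rest. *)
Lemma refine (s : stage) (N : nat) (e d : R) : stage_ok e s -> 0 <= e -> 0 < d ->
  exists r0, forall r, (r0 <= r)%N -> (0 < r)%N ->
  exists s' ch, [/\ period s' = (period s * r)%N,
    stage_ok d s', (forall y, (code s' y %% period s)%N = code s y) /\
    (forall y z, code s' y = code s' z -> agree N y z),
    forall k, (k < period s * r)%N -> `|L (rep s' k) - nominal_low s ch k| <= e + d /\
      `|ln (len (rep s' k)) - nominal_log s ch k| <= d &
    [/\ ch 0%N = (0, 0), ch r = (0, 0),
     forall j, [/\ subinterval (ch j), `|(ch j.+1).1 - (ch j).1| <= d
               & `|(ch j.+1).2 - (ch j).2| <= d] &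
     forall u, 0 <= u <= 1 -> exists j, [/\ (j < r)%N, `|(ch j).1 - u| <= d
       & expR (ch j).2 <= d]]].
Proof.
move=> ok e0 d0; have [q0 lcode codeq dom] := ok.
set q := period s in q0 codeq dom *.
have [w [lw wN wt]] := @fine_partition R L U FF (code s) d N lcode d0.
have [M wM] := locally_constant_bounded _ lw.
(* Each label gets a longest fibre and its relative position; an old representative is preferred in
   its own cell, as [partial_refinement] requires. *)
pose pos_ok a (x : cantor_space * (R * R)) := subinterval x.2 /\ forall y, w y = a ->
  [/\ w x.1 = a, longest L U [set y' | w y' = a] x.1,
   w (rep s (code s y)) = a -> x.1 = rep s (code s y),
   `|L x.1 - (L (rep s (code s y)) + len (rep s (code s y)) * x.2.1)| <= e &
   ln (len x.1) = ln (len (rep s (code s y))) + x.2.2].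
have /choice[zt ztP] : forall a, exists x, pos_ok a x.
  move=> a; have [[y ya]|/forallNP na] := pselect (exists y, w y = a); last first.
    exists (fun=> false, (0, 0)); split; last by move=> y /na.
    by split; rewrite /= ?expR0 ?add0r.
  have codeE y' : w y' = a -> code s y' = code s y.
    by move=> h; apply: (wN _ _ _).1; rewrite ya.
  have [crep lrep hrep] := dom _ (codeq y).
  have [z [lz zrep]] : exists z, longest L U [set y' | w y' = a] z /\
      (w (rep s (code s y)) = a -> z = rep s (code s y)).
    have [h|h] := pselect (w (rep s (code s y)) = a).
      exists (rep s (code s y)); split => //; split => // y' /= y'a.
      by have [] := hrep y' (codeE _ y'a).
    by have [z] := @longest_exists R L U FF _ y lw; rewrite ya => hz; exists z.
  have [wz mz] := lz; have zc := codeE _ wz.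
  have [hz1 hz2 hz3] := hrep z zc.
  have lenz : 0 < len z.
    have [n hn] := lw y; have [y' yy' /lt_le_trans] := @nondegenerate_dense R L U FF y n.
    by apply; apply: mz; rewrite /= (hn _ yy').
  have [t [t1 t2 t3]] := @relative_position (rep s (code s y)) z e lrep lenz e0 hz1 hz2 hz3.
  by exists (z, t); split => //= y' y'a; rewrite (codeE _ y'a).
pose G := (Num.truncn d^-1).+1.
have Gd : (G%:R : R)^-1 <= d.
  by rewrite -[leRHS]invrK lef_pV2 ?posrE ?invr_gt0 ?ltr0n //; exact/ltW/truncnS_gt.
have G0 : 0 < G%:R :> R by rewrite ltr0n.
(* The labels of [w] come first, then the grid; [- ln G%:R] encodes the length [1 / G]. *)
pose t b : R * R := if (b < M)%N then (zt b).2 else ((b - M)%:R / G%:R, - ln G%:R).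
have [] := @chain_through R (M + G) t d _ d0.
  move=> b bMG; rewrite /t; case: ltnP => [_|Mb]; first exact: (ztP b).1.
  split; rewrite /= ?divr_ge0 // expRN lnK // -[X in _ + X]mul1r -mulrDl.
  by rewrite ler_pdivrMr // mul1r natr1 ler_nat -subSn // leq_subLR.
move=> r0 [ch [pos [posI post [ch0 chr] chP]]]; exists r0 => r r0r rgt0.
have chsub j : subinterval (ch j) by have [] := chP j.
(* As [pos] is injective, [c] has the same cells as [w], while its residue mod [q] is the old
   code. *)
pose c y := (code s y + q * pos (w y))%N.
have cmod y : (c y %% q)%N = code s y by rewrite /c mulnC addnC modnMDl modn_small.
have cdiv y : (c y %/ q)%N = pos (w y).
  by rewrite /c mulnC addnC divnMDl // divn_small // addn0.
have cw y z : c y = c z <-> w y = w z.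
  split=> E; last by rewrite /c E (wN _ _ E).1.
  by apply: posI; rewrite -!cdiv E.
have placedz y : placed s ch e d c (c y) (zt (w y)).1.
  have [sub /(_ y erefl)[wz [_ mz] _ h1 h2]] := ztP (w y).
  have lz : 0 < len (zt (w y)).1.
    have [n hn] := lw y; have [y' yy' /lt_le_trans] := @nondegenerate_dense R L U FF y n.
    by apply; apply: mz; rewrite /= (hn _ yy').
  have tE : ch (pos (w y)) = (zt (w y)).2.
    by have [|_ ->] := post (w y); rewrite /t ?wM // (leq_trans (wM y)) ?leq_addr.
  split; first split=> //; first exact/cw.
  - move=> y' /cw y'y; split; first exact: mz.
      by have [] := wt y (zt (w y)).1 y' (conj wz mz) y'y.
    by have [] := wt y (zt (w y)).1 y' (conj wz mz) y'y.
  - by rewrite /nominal_low -/q cmod cdiv tE; apply: le_trans h1 _; rewrite lerDl ltW.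
  - by rewrite /nominal_log -/q cmod cdiv tE h2 subrr normr0 ltW.
have [] := @refined_stage s ch N r e d ok e0 d0 chsub c.
  split.
  - move=> y; have [n hn] := lcode y; have [m hm] := lw y; exists (maxn n m) => z yz.
    rewrite /c hn ?hm //; first by apply: agree_le yz; exact: leq_maxr.
    by apply: agree_le yz; exact: leq_maxl.
  - move=> y; split; last exact: cmod.
    rewrite -/q; have [|+ _] := post (w y); first by rewrite (leq_trans (wM y)) ?leq_addr.
    move=> /leq_trans/(_ r0r); have := codeq y; rewrite /c; nia.
  - by move=> y z /cw/wN[].
  - by move=> y; exists (zt (w y)).1.
  - move=> i iq; have [ci _ _] := dom _ iq.
    have [_ /(_ (rep s i) erefl)[_ _]] := ztP (w (rep s i)); rewrite ci => /(_ erefl) + _ _.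
    by move=> E; have := placedz (rep s i); rewrite E.
move=> s' [pers' oks' modc' finec' near']; exists s', ch; split => //; first exact: oks'.
split => //; first exact: chr.
move=> u /andP[u0 u1].
(* The cap [G.-1] handles [u = 1], where the grid interval would leave [[0, 1]]. *)
pose g := minn (Num.truncn (u * G%:R)) G.-1.
have gG : (g < G)%N by rewrite /g; lia.
have ug : `|g%:R / G%:R - u| <= d.
  apply: le_trans Gd.
  have -> : g%:R / G%:R - u = (g%:R - u * G%:R) / G%:R by field; apply: lt0r_neq0.
  rewrite normrM [X in _ * X]ger0_norm ?invr_ge0 ?(ltW G0) // -[leRHS]mul1r ler_pM2r ?invr_gt0 //.
  have uG0 : 0 <= u * G%:R by rewrite mulr_ge0 // ltW.
  have uG1 : u * G%:R <= G%:R by rewrite ler_piMl // ltW.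
  have /andP[tr1 tr2] := truncn_itv uG0.
  rewrite /g /minn; case: ltnP => h;
    first by rewrite ler_norml; apply/andP; split; move: tr2; rewrite -natr1; lra.
  have : (G.-1%:R : R) <= (Num.truncn (u * G%:R))%:R by rewrite ler_nat.
  have : G%:R = G.-1%:R + 1 :> R by rewrite natr1 /G.
  by rewrite ler_norml => ? ?; apply/andP; split; lra.
have [|p1 p2] := post (M + g)%N; first by rewrite ltn_add2l.
have tE : t (M + g)%N = (g%:R / G%:R, - ln G%:R).
  by rewrite /t ltnNge leq_addr /= addKn.
exists (pos (M + g)%N); split; first exact: leq_trans r0r.
  by rewrite p2 tE.
by rewrite p2 tE /= expRN lnK.
Qed.

End Refinement.

(** * The sequence of stages *)

Lemma expR_lipschitz (R : realType) (a b c : R) : a <= c -> b <= c ->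
  `|expR a - expR b| <= expR c * `|a - b|.
Proof.
wlog ba : a b / b <= a => [h ac bc|ac _].
  by have [/h|/ltW/h] := leP b a; [exact|rewrite distrC (distrC a); exact].
rewrite !ger0_norm ?subr_ge0 ?ler_expR //.
have -> : expR a - expR b = expR a * (1 - expR (b - a)).
  by rewrite mulrBr mulr1 -expRD (addrC b) addrA subrr add0r.
apply: ler_pM; rewrite ?expR_ge0 ?ler_expR // ?subr_ge0 ?expR_le1 ?subr_le0 //.
by have := expR_ge1Dx (b - a); lra.
Qed.

(** * Errors of geometric size *)

Section Eps.
Context {R : realType}.

(** With ratio 1/6 the slope error [3 * eps n.+1] is [eps n / 2], so a slope bound [1 - eps n]
    passes to [1 - eps n.+1]. *)
Definition eps (n : nat) : R := 6^-1 ^+ n.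

Lemma eps0 : eps 0 = 1. Proof. exact: expr0. Qed.
Lemma eps_gt0 n : 0 < eps n. Proof. by rewrite exprn_gt0 // invr_gt0. Qed.
Lemma epsS n : eps n = 6 * eps n.+1.
Proof. by rewrite /eps exprS mulrA divff ?mul1r // pnatr_eq0. Qed.

Lemma cvg_eps : eps @ \oo --> (0 : R).
Proof. by apply: cvg_expr; rewrite ger0_norm; lra. Qed.

Lemma eps_le (x : R) : 0 < x -> exists n, forall m, (n <= m)%N -> eps m <= x.
Proof.
move=> x0; have /cvgrPdist_le /(_ _ x0) [n _ hn] := cvg_eps.
exists n => m /hn; rewrite sub0r normrN ger0_norm // ltW //; exact: eps_gt0.
Qed.

Lemma cvg_of_eps (u : nat -> R) l C : (forall n, `|u n - l| <= C * eps n) ->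
  u @ \oo --> l.
Proof.
move=> h; have C0 : 0 <= C.
  by have := le_trans (normr_ge0 _) (h 0%N); rewrite /eps expr0 mulr1.
apply/cvgrPdist_le => e e0; have [|n hn] := eps_le (e / (C + 1)).
  by rewrite divr_gt0 //; lra.
exists n => // m /= /hn; rewrite ler_pdivlMr; last by lra.
have := h m; rewrite distrC; have := eps_gt0 m; nra.
Qed.

(** The intervals of radius [2 * C * eps n] around [u n] are nested; the supremum of their left ends
    lies in all of them. *)
Lemma geometric_limit (u : nat -> R) C : (forall n, `|u n.+1 - u n| <= C * eps n) ->
  exists l, forall n, `|u n - l| <= 2 * C * eps n.
Proof.
move=> h; have C0 : 0 <= C.
  by have := le_trans (normr_ge0 _) (h 0%N); rewrite /eps expr0 mulr1.
pose lo n := u n - 2 * C * eps n; pose hi n := u n + 2 * C * eps n.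
have lohi n : lo n <= lo n.+1 /\ hi n.+1 <= hi n.
  have := h n; rewrite /lo /hi epsS ler_norml; have := eps_gt0 n.+1.
  by move=> ? /andP[? ?]; split; nra.
have le_lo m n : (m <= n)%N -> lo m <= lo n.
  by move/subnK <-; elim: (n - m)%N => // k IH; apply: le_trans IH (lohi _).1.
have le_hi m n : (m <= n)%N -> hi n <= hi m.
  by move/subnK <-; elim: (n - m)%N => // k IH; apply: le_trans (lohi _).2 IH.
have lohi' m n : lo m <= hi n.
  have E k : lo k <= hi k by have := eps_gt0 k; rewrite /lo /hi; nra.
  have [mn|/ltnW nm] := leqP m n; first exact: le_trans (le_lo _ _ mn) (E n).
  exact: le_trans (E m) (le_hi _ _ nm).
have ub n : ubound (range lo) (hi n) by move=> _ [m _ <-].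
exists (sup (range lo)) => n.
have h1 : lo n <= sup (range lo).
  by apply: ub_le_sup; [exists (hi 0%N)|exists n].
have h2 : sup (range lo) <= hi n by apply: ge_sup => //; exists (lo 0%N), 0%N.
by move: h1 h2; rewrite /lo /hi ler_norml => *; apply/andP; split; lra.
Qed.

End Eps.

(** * Affine maps between successive representatives *)

Section Dynamics.
Context {R : realType}.
Variables (L U : cantor_space -> R) (p : nat -> nat).
Hypothesis FF : fraisse_fence L U.
Hypothesis podo : odometer_seq p.
Local Notation len := (len L U).
Local Notation stage_ok := (stage_ok L U).


(* The affine map [t |-> expR (log_slope s k) * t + shift s k] takes the fibre
   of [rep s k] onto the fibre of the next representative in cyclic order. *)
Definition log_slope (s : stage) k : R :=
  ln (len (rep s (k.+1 %% period s)%N)) - ln (len (rep s k)).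
Definition shift (s : stage) k : R :=
  L (rep s (k.+1 %% period s)%N) - expR (log_slope s k) * L (rep s k).

Lemma odometer_gt i : (i < p i)%N.
Proof.
elim: i => [|i IH]; first by have [] := podo 0.
by have [_ [_]] := podo i; exact: leq_ltn_trans.
Qed.

Lemma odometer_dvd i j : (i <= j)%N -> (p i %| p j)%N.
Proof.
move/subnK <-; elim: (j - i)%N => // k IH.
by apply: dvdn_trans IH _; have [_ []] := podo (k + i).
Qed.

(** The slope bound leaves room for all later perturbations while every scaling factor stays below
    [expR 1]. The period is only asked to divide a term of [p] because the first period is 1. *)
Definition invariant n s := [/\ stage_ok (eps n) s,
  forall i, (i < period s)%N -> log_slope s i <= 1 - eps n &
  exists j, (period s %| p j)%N].

(* The last clause gives minimality: the short fibres of [s'] come close to every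
   point of the fibres of [s]. *)
Definition step n (s s' : stage) := [/\
  (exists2 j, (n <= j)%N & period s' = p j) /\ (period s %| period s')%N,
  (forall y, (code s' y %% period s)%N = code s y),
  (forall y z, code s' y = code s' z -> agree n y z),
  (forall k, (k < period s')%N ->
     `|log_slope s' k - log_slope s (k %% period s)%N| <= 2^-1 * eps n /\
     `|shift s' k - shift s (k %% period s)%N| <= 8 * expR 1 * eps n) &
  forall i t, (i < period s)%N -> L (rep s i) <= t <= U (rep s i) ->
    exists k, [/\ (k < period s')%N, (k %% period s = i)%N &
      forall y t', code s' y = k -> L y <= t' <= U y -> `|t' - t| <= 2 * eps n]].

(** The slope compares two log lengths, each within [d] of nominal, and the nominal values add one
    chain step: hence [3 * d]. *)
Lemma slope_shift_close s s' ch r k (e d : R) :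
  stage_ok e s -> 0 <= e -> 0 < d -> d <= e -> 3 * d <= 1 -> (0 < r)%N ->
  (forall i, (i < period s)%N -> log_slope s i <= 1 - 3 * d) ->
  period s' = (period s * r)%N ->
  (forall k, (k < period s * r)%N -> 0 < len (rep s' k) /\
    `|L (rep s' k) - nominal_low L U s ch k| <= e + d /\
      `|ln (len (rep s' k)) - nominal_log L U s ch k| <= d) ->
  ch 0%N = (0, 0) -> ch r = (0, 0) ->
  (forall j, [/\ subinterval (ch j), `|(ch j.+1).1 - (ch j).1| <= d
               & `|(ch j.+1).2 - (ch j).2| <= d]) ->
  (k < period s * r)%N ->
  `|log_slope s' k - log_slope s (k %% period s)%N| <= 3 * d /\
  `|shift s' k - shift s (k %% period s)%N| <= 8 * expR 1 * e.
Proof.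
move=> [q0 _ _ dom] e0 d0 de d1 r0 slope pers' near ch0 chr chP kqr.
set q := period s in q0 dom kqr pers' near slope *.
set i := (k %% q)%N; set j := (k %/ q)%N.
have iq : (i < q)%N by rewrite ltn_mod.
have kE : k = (j * q + i)%N by exact: divn_eq.
have jr : (j < r)%N by rewrite ltn_divLR // mulnC.
set k' := (k.+1 %% (q * r))%N.
have k'qr : (k' < q * r)%N by rewrite ltn_mod muln_gt0 q0.
have k'i : (k' %% q = i.+1 %% q)%N.
  by rewrite /k' modn_dvdm ?dvdn_mulr // kE -addnS modnMDl.
(* The chain position changes only when the residue mod [q] wraps around; after the last cell it
   returns to the start since [ch r] equals [ch 0]. *)
have chstep : `|(ch (k' %/ q)%N).1 - (ch j).1| <= d /\ `|(ch (k' %/ q)%N).2 - (ch j).2| <= d.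
  have [iq1|qi1] := ltnP i.+1 q.
    have kq : (k.+1 < q * r)%N by rewrite kE; nia.
    rewrite /k' modn_small // kE -addnS divnMDl // divn_small // addn0 !subrr normr0.
    by split; exact: ltW.
  have iqE : i.+1 = q by apply/eqP; rewrite eqn_leq iq.
  have kS : k.+1 = (j.+1 * q)%N by rewrite kE -addnS iqE mulSnr.
  have -> : ch (k' %/ q)%N = ch j.+1.
    have [jr1|rj1] := ltnP j.+1 r.
      by rewrite /k' kS modn_small ?mulnK // mulnC ltn_pmul2l.
    have jE : j.+1 = r by apply/eqP; rewrite eqn_leq jr.
    by rewrite /k' kS jE (mulnC r) modnn div0n ch0 chr.
  by have [_ ? ?] := chP j.
have [lk [Lk lnk]] := near _ kqr; have [lk' [Lk' lnk']] := near _ k'qr.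
rewrite /nominal_low /nominal_log -/q k'i -/i -/j in Lk lnk Lk' lnk'.
have slopek : `|log_slope s' k - log_slope s i| <= 3 * d.
  rewrite /log_slope pers' -/q -/k'; move: lnk lnk' chstep.2.
  rewrite !ler_norml => /andP[? ?] /andP[? ?] /andP[? ?].
  by apply/andP; split; lra.
split => //.
have [u0 u1] : 0 <= (ch j).1 /\ (ch j).1 <= 1.
  have [[h1 h2] _ _] := chP j; split => //.
  by have := expR_gt0 (ch j).2; lra.
have slopei := slope _ iq.
have E0 : 1 <= expR 1 :> R by have := expR_ge1Dx (1 : R); lra.
have slope_k1 : log_slope s' k <= 1.
  by move: slopek slopei; rewrite ler_norml => /andP[]; lra.
have slope_i1 : log_slope s i <= 1 by apply: le_trans slopei _; lra.
have expd := @expR_lipschitz R (log_slope s' k) (log_slope s i) 1 slope_k1 slope_i1.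
have expk : expR (log_slope s' k) <= expR 1 by rewrite ler_expR.
have [_ li _] := dom _ iq; have [_ li' _] := dom _ (ltn_pmod i.+1 q0).
have expi : expR (log_slope s i) * len (rep s i) = len (rep s (i.+1 %% q)%N).
  by rewrite /log_slope expRB !lnK // divfK ?lt0r_neq0.
rewrite /shift pers' -/q -/k'.
set a := L (rep s' k) in Lk *; set a' := L (rep s' k') in Lk' *.
set b := L (rep s i) in Lk *; set b' := L (rep s (i.+1 %% q)%N) in Lk' *.
set l := len (rep s i) in Lk expi *; set l' := len (rep s (i.+1 %% q)%N) in Lk' expi *.
set u := (ch j).1 in Lk u0 u1 chstep *; set u' := (ch _).1 in Lk' chstep.
set g := expR (log_slope s' k) in expd expk *; set h := expR (log_slope s i) in expd expi *.
(* The four terms are the chain step, the placement errors of the two new representatives, and the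
   change of the scaling factor. *)
have -> : a' - g * a - (b' - h * b) =
  l' * (u' - u) + (a' - (b' + l' * u')) - g * (a - (b + l * u)) - (g - h) * (b + l * u).
  by rewrite -expi; ring.
have bl : 0 <= b + l * u <= 1.
  have lb : 0 <= l by exact: len_ge0.
  have := fence_ge0 _ _ FF (rep s i); have := fence_le1 _ _ FF (rep s i).
  rewrite -/b => h1 h2; rewrite addr_ge0 ?mulr_ge0 //=.
  have := ler_wpM2l lb u1; rewrite mulr1 {2}/l /len -/b; lra.
have n1 : `|l' * (u' - u)| <= d.
  rewrite normrM -[leRHS]mul1r ler_pM // ?chstep.1 //.
  by rewrite ger0_norm ?len_ge0 // len_le1.
have n2 : `|g * (a - (b + l * u))| <= expR 1 * (e + d).
  by rewrite normrM ler_pM // ger0_norm ?expR_ge0.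
have n3 : `|(g - h) * (b + l * u)| <= expR 1 * (3 * d).
  rewrite normrM -[leRHS]mulr1 ler_pM //; last by rewrite ger0_norm; case/andP: bl.
  by apply: le_trans expd _; rewrite ler_pM2l ?expR_gt0.
(* As [d <= e] and [1 <= expR 1], the sum is at most [3 * e + 5 * expR 1 * e], whence the constant
   8. *)
have : d + (e + d) + expR 1 * (e + d) + expR 1 * (3 * d) <= 8 * expR 1 * e by nra.
apply: le_trans; apply: le_trans (ler_normB _ _) (lerD _ n3).
apply: le_trans (ler_normB _ _) (lerD _ n2).
by apply: le_trans (ler_normD _ _) (lerD _ _).
Qed.

Lemma next_stage n s : invariant n s -> exists s', invariant n.+1 s' /\ step n s s'.
Proof.
move=> [ok slope [j0 j0P]]; have en := eps_gt0 n.+1 (R := R).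
have e1 : eps n <= 1 :> R by apply: exprn_ile1; lra.
have [r0 hr0] := @refine R L U FF s n (eps n) (eps n.+1) ok (ltW (eps_gt0 n)) en.
have [q0 lc cq dom] := ok.
(* [J >= n] makes the periods cofinal in [p], [J >= j0] makes the old period divide [p J], and the
   last bound gives [r0 <= r] since [p J > J]. *)
pose J := (maxn n (maxn j0 (period s * r0)))%N.
have qJ : (period s %| p J)%N by apply: dvdn_trans j0P _; apply: odometer_dvd; rewrite /J; lia.
pose r := (p J %/ period s)%N.
have qr : (period s * r = p J)%N by rewrite mulnC divnK.
have JpJ := odometer_gt J.
have r0r : (r0 <= r)%N by rewrite leq_divRL // mulnC; rewrite /J in JpJ *; lia.
have rgt0 : (0 < r)%N by rewrite divn_gt0 // dvdn_leq //; lia.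
have [s' [ch [pers' ok' [modc finec] near [ch0 chr chP chdense]]]] := hr0 r r0r rgt0.
have [q0' lc' cq' dom'] := ok'.
have close k (kqr : (k < period s * r)%N) := @slope_shift_close s s' ch r k (eps n) (eps n.+1)
  ok (ltW (eps_gt0 n)) en.
have {close}close : forall k, (k < period s')%N ->
     `|log_slope s' k - log_slope s (k %% period s)%N| <= 2^-1 * eps n /\
     `|shift s' k - shift s (k %% period s)%N| <= 8 * expR 1 * eps n.
  move=> k; rewrite pers' => kqr.
  have [||||] := close k kqr _ _ rgt0 _ pers' _ ch0 chr chP kqr.
  - by rewrite (epsS n); lra.
  - by move: e1; rewrite (epsS n); lra.
  - by move=> i /slope; rewrite (epsS n); lra.
  - move=> k1 k1qr; split; last exact: near.
    by have [] := dom' k1; rewrite ?pers'.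
  - by move=> h1 h2; split => //; move: h1; rewrite (epsS n); lra.
exists s'; split.
  split => //; last by exists J; rewrite pers' qr.
  move=> k kq'; have [h _] := close k kq'.
  have := slope (k %% period s)%N; rewrite ltn_mod q0 => /(_ isT).
  by move: h; rewrite ler_norml (epsS n) => /andP[]; lra.
split => //.
  by rewrite pers' dvdn_mulr //; split => //; exists J => //; rewrite /J leq_maxl.
(* A short chain interval near the relative position of [t] gives a cell all of whose fibres are
   close to [t]. *)
move=> i t iq /andP[Lt tU].
have [_ li _] := dom _ iq.
have [|j [jr ju jv]] := chdense ((t - L (rep s i)) / len (rep s i)).
  apply/andP; split; first by apply: divr_ge0; [rewrite subr_ge0|exact: ltW].
  by rewrite ler_pdivrMr // mul1r lerB.
have kq : (i + period s * j < period s * r)%N by move: iq jr; nia.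
exists (i + period s * j)%N; rewrite pers'; split => //.
  by rewrite mulnC addnC modnMDl modn_small.
move=> y t' yk /andP[Lt' t'U].
have [h1 h2] := near _ kq.
rewrite /nominal_low /nominal_log mulnC addnC modnMDl modn_small // in h1 h2.
rewrite divnMDl // divn_small // addn0 in h1 h2.
rewrite addnC mulnC in h1 h2.
set k := (i + period s * j)%N in yk h1 h2.
have [_ lk /(_ y yk)[_ Ly Uy]] := dom' k (eq_ind_r (fun x => (k < x)%N) kq pers').
have lent : `|len (rep s i) * (ch j).1 - (t - L (rep s i))| <= eps n.+1.
  rewrite -[t - _](divfK (lt0r_neq0 li)) mulrC -mulrBl normrM -[leRHS]mulr1.
  by rewrite ler_pM // ger0_norm ?len_ge0 // len_le1.
have lenk : len (rep s' k) <= 2 * eps n.+1.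
  rewrite -[leLHS]lnK //.
  set x := ln (len (rep s' k)) - (ln (len (rep s i)) + (ch j).2) in h2.
  have lnE : ln (len (rep s' k)) = ln (len (rep s i)) + (ch j).2 + x by rewrite /x; ring.
  move: x h2 lnE => x h2 ->.
  rewrite !expRD lnK //.
  have x2 : expR x <= 2.
    have := expR_ge1Dx (- x); rewrite expRN.
    have x0 := expR_gt0 x; set f := expR x in x0 *.
    have : x <= 2^-1 by move: h2 e1; rewrite (epsS n) ler_norml => /andP[]; lra.
    move=> h3 h4; have : 2^-1 <= f^-1 by lra.
    by rewrite lef_pV2 ?posrE.
  have li0 := ltW li; rewrite mulrC; apply: ler_pM => //; rewrite ?expR_ge0 //.
    by rewrite mulr_ge0 ?expR_ge0.
  rewrite -[leRHS]mul1r; apply: ler_pM; rewrite ?expR_ge0 //.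
  exact: len_le1.
(* The errors add up to at most [eps n + 5 * eps n.+1], which is below [2 * eps n]. *)
move: h1 lent lenk; rewrite /len (epsS n) !ler_norml => /andP[? ?] /andP[? ?] ?.
by apply/andP; split; lra.
Qed.

(** With one cell the tolerance [eps 0 = 1] is automatic, and the slope 0 meets the bound
    [1 - eps 0]. *)
Lemma initial_stage : exists s, invariant 0 s /\ period s = 1%N.
Proof.
have lc : locally_constant (fun=> 0%N) by move=> y; exists 0%N.
have [z [_ mz]] := @longest_exists R L U FF _ (fun=> false) lc.
exists (Stage 1 (fun=> 0%N) (fun=> z)); split => //; rewrite /invariant eps0.
split => /=.
- split => //= i; rewrite ltnS leqn0 => /eqP ->; split => //.
    have [y _ /lt_le_trans] := @nondegenerate_dense R L U FF z 0%N.
    by apply; apply: mz.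
  move=> y _; have := fence_ge0 _ _ FF y; have := fence_ge0 _ _ FF z.
  have := fence_le1 _ _ FF y; have := fence_le1 _ _ FF z.
  have := fence_le _ _ FF y; have := fence_le _ _ FF z.
  by split; [exact: mz|lra|lra].
- by move=> i _; rewrite /log_slope /= !subrr.
- by exists 0%N; exact: dvd1n.
Qed.

Lemma stage_sequence : exists st : nat -> stage,
  period (st 0%N) = 1%N /\ forall n, invariant n (st n) /\ step n (st n) (st n.+1).
Proof.
have [s0 [inv0 per0]] := initial_stage.
have /choice[f fP] : forall x : nat * stage, exists s', invariant x.1 x.2 ->
    invariant x.1.+1 s' /\ step x.1 x.2 s'.
  move=> [n s]; have [inv|ninv] := pselect (invariant n s); last by exists s0.
  by have [s' h] := next_stage _ _ inv; exists s'.
pose st := fix st n := if n is m.+1 then f (m, st m) else s0.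
exists st; split => // n.
have inv : invariant n (st n) by elim: n => //= n /(fP (n, st n))[].
by split => //; exact: (fP (n, st n) inv).2.
Qed.

End Dynamics.

(** * The limit system *)

Section Limit.
Context {R : realType}.
Variables (L U : cantor_space -> R) (p : nat -> nat) (st : nat -> stage).
Hypothesis FF : fraisse_fence L U.
Hypothesis podo : odometer_seq p.
Hypothesis st0 : period (st 0%N) = 1%N.
Hypothesis stP : forall n, invariant L U p n (st n) /\ step L U p n (st n) (st n.+1).
Local Notation q n := (period (st n)).
Local Notation c n := (code (st n)).
Local Notation x n := (rep (st n)).

Lemma period_gt0 n : (0 < q n)%N. Proof. by have [[[] ]] := stP n. Qed.

Lemma code_lt n y : (c n y < q n)%N. Proof. by have [[[_ _ h _] _ _] _] := stP n; exact: h. Qed.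

Lemma code_lc n : locally_constant (c n). Proof. by have [[[_ h _ _] _ _] _] := stP n. Qed.

Lemma rep_dominates n i : (i < q n)%N -> dominates L U (c n) (eps n) i (x n i).
Proof. by have [[[_ _ _ h] _ _] _] := stP n; exact: h. Qed.

Lemma code_fine n y z : c n.+1 y = c n.+1 z -> agree n y z.
Proof. by have [_ [_ _ h _ _]] := stP n; exact: h. Qed.

Lemma period_dvd m n : (m <= n)%N -> (q m %| q n)%N.
Proof.
move/subnK <-; elim: (n - m)%N => // k IH; apply: dvdn_trans IH _.
by have [_ [[_ h]]] := stP (k + m)%N.
Qed.

(** These are the points of the inverse limit of the [Z / q n], with which [coherent_code],
    [code_inj] and [code_surj] identify the Cantor space. *)
Definition coherent (k : nat -> nat) :=
  forall n, (k n < q n)%N /\ (k n.+1 %% q n)%N = k n.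

Lemma coherentE k m n : coherent k -> (m <= n)%N -> (k n %% q m)%N = k m.
Proof.
move=> hk /subnK <-; elim: (n - m)%N => [|d IH]; first by rewrite modn_small // (hk m).1.
by rewrite -IH -(hk (d + m)%N).2 modn_dvdm // period_dvd // leq_addl.
Qed.

Lemma coherent_code y : coherent (fun n => c n y).
Proof. by move=> n; split; [exact: code_lt|have [_ [_ h _ _ _]] := stP n; exact: h]. Qed.

Lemma odometer_dvd_period i : (p i %| q i.+1)%N.
Proof. by have [_ [[[j ij ->] _] _ _ _ _]] := stP i; exact: odometer_dvd. Qed.

Lemma code_inj y z : (forall n, c n y = c n z) -> y = z.
Proof. by move=> h; apply/funext => i; apply: (code_fine i.+1) (h _) _ _. Qed.

Lemma code_surj k : coherent k -> exists y, forall n, c n y = k n.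
Proof.
move=> hk; have rep_code m n : (m <= n)%N -> c m (x n (k n)) = k m.
  move=> mn; rewrite -(coherentE _ _ _ (coherent_code _) mn).
  have [-> _ _] := rep_dominates n (k n) (hk n).1.
  exact: coherentE.
(* A code at level [i.+2] determines the first [i.+1] coordinates, in particular coordinate [i]. *)
pose y : cantor_space := fun i => x i.+2 (k i.+2) i.
have yx m n : (m <= n)%N -> agree m y (x n.+2 (k n.+2)).
  move=> mn i im; rewrite /y; apply: (code_fine i.+1) => //.
  by rewrite !rep_code //; lia.
exists y => n; have [N hN] := code_lc n y.
have /hN <- := yx N (maxn N n) (leq_maxl _ _).
by rewrite rep_code //; lia.
Qed.

Lemma odometer_lift (w : natseq) : odometer_space p w ->
  exists y, forall i, w i = (c i.+1 y %% p i)%N.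
Proof.
move=> hw; have per n : exists j, if n is m.+1 then (m <= j)%N /\ q n = p j else True.
  by case: n => [|n]; [exists 0%N|have [_ [[[j ? ?] _] _ _ _ _]] := stP n; exists j].
have /choice[j jP] := per.
have wE m n : (m <= n)%N -> (w n %% p m)%N = w m.
  move/subnK <-; elim: (n - m)%N => [|d IH]; first by rewrite modn_small // (hw m).1.
  by rewrite -IH (hw (d + m)%N).2 modn_dvdm // odometer_dvd // leq_addl.
pose k n := if n is m.+1 then w (j n) else 0%N.
have [|y hy] := code_surj k.
  case=> [|n]; first by rewrite st0 modn1.
  have [jn qn] := jP n.+1; have [jn' qn'] := jP n.+2.
  rewrite /k qn; split; first exact: (hw _).1.
  (* The indices are monotone because the periods divide one another and [p] is strictly
     increasing. *)
  have jj : (j n.+1 <= j n.+2)%N.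
    rewrite leqNgt; apply/negP => lt.
    have := dvdn_leq (period_gt0 n.+2) (period_dvd _ _ (leqnSn n.+1)).
    rewrite qn qn' leqNgt => /negP; apply.
    move: lt; elim: (j n.+1) => // a IH; rewrite ltnS leq_eqVlt.
    have [_ [_ pa]] := podo a.
    by case/orP => [/eqP -> //|/IH h]; exact: ltn_trans pa.
  by rewrite wE.
exists y => i; rewrite hy /k; have [ij _] := jP i.+1.
by rewrite wE.
Qed.

(** Translation by an element of the inverse limit, needed for 1 and, as [(q n).-1], for its
    inverse. *)
Lemma rotation_exists (a : nat -> nat) :
  (forall n, a n.+1 = a n %[mod q n]) -> exists S : cantor_space -> cantor_space,
  forall y n, c n (S y) = ((c n y + a n) %% q n)%N.
Proof.
move=> ha; have /choice[S hS] : forall y, exists z, forall n, c n z = ((c n y + a n) %% q n)%N.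
  move=> y; apply: (code_surj (fun n => (c n y + a n) %% q n)%N) => n.
  rewrite ltn_mod period_gt0 modn_dvdm ?period_dvd //; split => //.
  by rewrite -modnDm ha (coherent_code y n).2 modnDmr.
by exists S.
Qed.

Lemma continuous_code (f : cantor_space -> cantor_space) :
  (forall n y z, c n y = c n z -> c n (f y) = c n (f z)) -> continuous f.
Proof.
move=> hf y V /nbhs_cantorP[n nV]; have [m hm] := code_lc n.+1 y.
apply/nbhs_cantorP; exists m => z /hm zy; apply: nV; apply: code_fine.
exact/esym/hf.
Qed.

(** A uniform limit of locally constant functions. *)
Lemma continuous_of_code (f : cantor_space -> R) (f_ : nat -> nat -> R) C :
  (forall n y, `|f_ n (c n y) - f y| <= C * eps n) -> continuous f.
Proof.
move=> hf y; apply/cvgrPdist_le => e e0.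
have C0 : 0 <= C by have := le_trans (normr_ge0 _) (hf 0%N y); rewrite eps0 mulr1.
have [|n hn] := eps_le (e / (2 * C + 1)); first by rewrite divr_gt0 //; lra.
have [m hm] := code_lc n y; apply/nbhs_cantorP; exists m => z /hm zy /=.
have := hf n y; have := hf n z; rewrite zy !ler_norml.
have := hn n (leqnn n); rewrite ler_pdivlMr; last by lra.
have := eps_gt0 n (R := R) => ? ? /andP[? ?] /andP[? ?].
by apply/andP; split; nra.
Qed.

(** The representatives of the cells of [y] tend to [y]: semicontinuity bounds their fibres from
    outside, domination from inside. *)
Lemma rep_cvg y : (fun n => L (x n (c n y))) @ \oo --> L y /\
  (fun n => U (x n (c n y))) @ \oo --> U y.
Proof.
have key (e : R) : 0 < e -> exists n, forall m, (n <= m)%N ->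
    `|L y - L (x m (c m y))| <= e /\ `|U y - U (x m (c m y))| <= e.
  move=> e0; have [n hn] := @fence_semicontinuous R L U FF y e e0.
  have [n' hn'] := eps_le e e0; exists (maxn n.+1 n') => m mn.
  have [cm _ /(_ y erefl)[_ Ly Uy]] := rep_dominates m _ (code_lt m y).
  have [|h1 h2] := hn (x m (c m y)).
    have -> : m = m.-1.+1 by lia.
    apply: agree_le (code_fine m.-1 _ _ _); first by lia.
    by rewrite prednK ?cm //; lia.
  have := hn' m; rewrite !ler_norml => /(_ _) em.
  have {}em : eps m <= e by apply: em; lia.
  by split; apply/andP; split; lra.
by split; apply/cvgrPdist_le => e /key[n hn]; exists n => // m /hn[].
Qed.

(** Both coefficients change by at most a constant times [eps n], uniformly in [y]. *)
Lemma affine_limits : exists lam beta : cantor_space -> R,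
  [/\ continuous lam, continuous beta & forall y,
    (fun n => log_slope L U (st n) (c n y)) @ \oo --> lam y /\
    (fun n => shift L U (st n) (c n y)) @ \oo --> beta y].
Proof.
have close n y := (let: conj _ (And5 _ _ _ h _) := stP n in h) (c n.+1 y) (code_lt n.+1 y).
have /choice[lam hlam] : forall y, exists l, forall n,
    `|log_slope L U (st n) (c n y) - l| <= 2 * 2^-1 * eps n.
  move=> y; apply: geometric_limit => n; have [+ _] := close n y.
  by rewrite (coherent_code y n).2.
have /choice[beta hbeta] : forall y, exists l, forall n,
    `|shift L U (st n) (c n y) - l| <= 2 * (8 * expR 1) * eps n.
  move=> y; apply: geometric_limit => n; have [_] := close n y.
  by rewrite (coherent_code y n).2.
exists lam, beta; split.
- exact: (continuous_of_code _ (fun n => log_slope L U (st n)) _ (fun n y => hlam y n)).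
- exact: (continuous_of_code _ (fun n => shift L U (st n)) _ (fun n y => hbeta y n)).
- by move=> y; split; apply: cvg_of_eps; [exact: hlam|exact: hbeta].
Qed.

(** At each stage the affine map carries the endpoints over the representatives exactly; [rep_cvg]
    passes this to the limit. *)
Lemma affine_equivariance S lam beta :
  (forall y n, c n (S y) = ((c n y).+1 %% q n)%N) ->
  (forall y, (fun n => log_slope L U (st n) (c n y)) @ \oo --> lam y /\
    (fun n => shift L U (st n) (c n y)) @ \oo --> beta y) ->
  forall y, L (S y) = expR (lam y) * L y + beta y /\
            U (S y) = expR (lam y) * U y + beta y.
Proof.
move=> hS hlim y; have [hlam hbeta] := hlim y.
have hexp : (fun n => expR (log_slope L U (st n) (c n y))) @ \oo --> expR (lam y).
  by apply: continuous_cvg hlam; exact: continuous_expR.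
have [hL hU] := rep_cvg y; have [hLS hUS] := rep_cvg (S y).
have lim (f : nat -> R) l : f @ \oo --> l ->
    (fun n => expR (log_slope L U (st n) (c n y)) * f n + shift L U (st n) (c n y)) @ \oo
      --> expR (lam y) * l + beta y.
  by move=> hf; apply: cvgD => //; apply: cvgM.
split.
  have E n : expR (log_slope L U (st n) (c n y)) * L (x n (c n y)) + shift L U (st n) (c n y)
      = L (x n (c n (S y))) by rewrite /shift hS addrC subrK.
  by apply: (cvg_unique (@Rhausdorff R) hLS); move: (lim _ _ hL); rewrite (eq_cvg _ _ E).
have E n : expR (log_slope L U (st n) (c n y)) * U (x n (c n y)) + shift L U (st n) (c n y)
    = U (x n (c n (S y))).
  have iq : ((c n y).+1 %% q n < q n)%N by rewrite ltn_mod period_gt0.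
  have [_ l0 _] := rep_dominates n _ (code_lt n y).
  have [_ l1 _] := rep_dominates n _ iq.
  have : expR (log_slope L U (st n) (c n y)) * len L U (x n (c n y)) =
      len L U (x n ((c n y).+1 %% q n)%N).
    by rewrite /log_slope expRB !lnK // divfK ?lt0r_neq0.
  by rewrite /shift hS /len; lra.
by apply: (cvg_unique (@Rhausdorff R) hUS); move: (lim _ _ hU); rewrite (eq_cvg _ _ E).
Qed.

Lemma limit_system : exists T : cantor_space * R -> cantor_space * R,
  minimal_on (fence L U) T /\
  factor_of (fence L U) T (odometer_space p) (odometer_map p).
Proof.
have [//|S hS] := rotation_exists (fun=> 1%N).
have [n|S' hS'] := rotation_exists (fun n => (q n).-1).
  have /dvdnP[d dE] := period_dvd _ _ (leqnSn n); have := period_gt0 n.+1; have := period_gt0 n.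
  rewrite dE; case: d {dE} => // d; case: (q n) => // a _ _.
  by rewrite mulSn addSn /= addnC -[RHS](modnMDl d).
have {}hS y n : c n (S y) = ((c n y).+1 %% q n)%N by rewrite hS addn1.
have SS' y : S (S' y) = y.
  apply: code_inj => n; rewrite hS hS' -addn1 modnDml addn1 -addnS prednK ?period_gt0 //.
  by rewrite modnDr modn_small // code_lt.
have S'S y : S' (S y) = y.
  apply: code_inj => n; rewrite hS' hS modnDml addSnnS prednK ?period_gt0 //.
  by rewrite modnDr modn_small // code_lt.
have cS : continuous S by apply: continuous_code => n y z; rewrite !hS => ->.
have cS' : continuous S' by apply: continuous_code => n y z; rewrite !hS' => ->.
have [lam [beta [clam cbeta hlim]]] := affine_limits.
have equi := affine_equivariance S lam beta hS hlim.
pose T (z : cantor_space * R) := (S z.1, expR (lam z.1) * z.2 + beta z.1).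
pose G (z : cantor_space * R) := (S' z.1, expR (- lam (S' z.1)) * (z.2 - beta (S' z.1))).
have TF z : fence L U z -> fence L U (T z).
  move=> /andP[h1 h2]; have [E1 E2] := equi z.1; rewrite /fence /= E1 E2.
  by rewrite !lerD2r !ler_pM2l ?expR_gt0 // h1.
have GT z : G (T z) = z.
  case: z => y t; rewrite /G /T /= S'S; congr pair.
  by rewrite addrK mulrA -expRD addNr expR0 mul1r.
have TG z : T (G z) = z.
  case: z => y t; rewrite /G /T /= SS'; congr pair.
  by rewrite mulrA -expRD subrr expR0 mul1r subrK.
have GF z : fence L U z -> fence L U (G z).
  rewrite -{1}(TG z); case: (G z) => y t; rewrite /fence /T /=; have [-> ->] := equi y.
  by rewrite !lerD2r !ler_pM2l ?expR_gt0.
have fstc (g : cantor_space -> R) : continuous g ->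
    continuous (fun z : cantor_space * R => g z.1).
  by move=> cg z; apply: continuous_comp; [exact: cvg_fst|exact: cg].
have cexp (g : cantor_space -> R) : continuous g -> continuous (fun y => expR (g y)).
  by move=> cg z; apply: continuous_comp; [exact: cg|exact: continuous_expR].
have pairc (f : cantor_space -> cantor_space) (a b : cantor_space -> R) :
    continuous f -> continuous a -> continuous b ->
    continuous (fun z : cantor_space * R => (f z.1, a z.1 * z.2 + b z.1)).
  move=> cf ca cb z.
  have cf' : continuous (fun z : cantor_space * R => f z.1).
    by move=> z'; apply: continuous_comp; [exact: cvg_fst|exact: cf].
  have cab : continuous (fun z : cantor_space * R => a z.1 * z.2 + b z.1).
    move=> [y t].
    have ha : a z'.1 @[z' --> ((y, t) : cantor_space * R)] --> a y by exact: fstc.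
    have hb : b z'.1 @[z' --> ((y, t) : cantor_space * R)] --> b y by exact: fstc.
    have ht : z'.2 @[z' --> ((y, t) : cantor_space * R)] --> t by exact: cvg_snd.
    exact: (cvgD (cvgM ha ht) hb).
  exact: (cvg_pair (cf' z) (cab z)).
have cT : continuous T by exact: (pairc S _ beta cS (cexp _ clam) cbeta).
have cG : continuous G.
  have cc (g : cantor_space -> R) : continuous g -> continuous (g \o S').
    by move=> cg z; apply: continuous_comp; [exact: cS'|exact: cg].
  have cexpN : continuous (fun y => expR (- lam (S' y))).
    by apply: cexp => y; exact: (cvgN (cc _ clam y)).
  have -> : G = fun z => (S' z.1, expR (- lam (S' z.1)) * z.2 +
      - (expR (- lam (S' z.1)) * beta (S' z.1))).
    by apply/funext => z; rewrite /G mulrBr.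
  have cb : continuous (fun y => - (expR (- lam (S' y)) * beta (S' y))).
    by move=> y; exact: (cvgN (cvgM (cexpN y) (cc _ cbeta y))).
  exact: (pairc S' _ _ cS' cexpN cb).
have iterT m z : fence L U z -> fence L U (iter m T z) /\
    forall n, c n (iter m T z).1 = ((c n z.1 + m) %% q n)%N.
  move=> zF; elim: m => [|m [IH1 IH2]].
    by split => // n; rewrite addn0 modn_small // code_lt.
  split => [|n]; first exact: TF.
  by rewrite iterS /T /= hS IH2 -addn1 modnDml addn1 addnS.
exists T; split.
  split.
    exists G; split => //.
    by split; apply: continuous_subspaceT.
  move=> z zF [y t] ytF B [[P Q] [/= /nbhs_cantorP[n0 n0P] /nbhs_ballP[e /= e0 eQ]] PQB].
  have [|n1 hn1] := eps_le (e / 4); first by rewrite divr_gt0.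
  pose n := maxn n0.+1 n1.
  have en : eps n <= e / 4 by apply: hn1; exact: leq_maxr.
  have iq := code_lt n y.
  have [_ l0 /(_ y erefl)[_ Ly Uy]] := rep_dominates n _ iq.
  have /andP[Lt tU] := ytF.
  (* The point [t] may lie outside the representative's fibre, by at most [eps n], so it is first
     moved to the nearest point there. *)
  have [t' t'rep tt'] : exists2 t', L (x n (c n y)) <= t' <= U (x n (c n y)) & `|t - t'| <= eps n.
    have LU := fence_le _ _ FF (x n (c n y)); have e1 := eps_gt0 n (R := R).
    have [tL|Lt'] := leP t (L (x n (c n y))).
      exists (L (x n (c n y))); first by rewrite lexx.
      by rewrite ler_norml; apply/andP; split; move: Lt => /= Lt; lra.
    have [tU'|Ut'] := leP t (U (x n (c n y))).
      by exists t; [rewrite tU' ltW|rewrite subrr normr0 ltW].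
    exists (U (x n (c n y))); first by rewrite lexx LU.
    by rewrite ler_norml; apply/andP; split; move: tU => /= tU; lra.
  have [_ [_ _ _ _ /(_ _ _ iq t'rep)[k [kq kmod kP]]]] := stP n.
  (* Advancing [z] by [m] adds [m] to its code and gives [k] modulo [q n.+1]; the forward orbit thus
     suffices. *)
  pose m := (k + (q n.+1 - c n.+1 z.1))%N.
  have [mF mc] := iterT m z zF.
  have ck : c n.+1 (iter m T z).1 = k.
    rewrite mc /m addnCA subnKC ?modnDr ?modn_small //; exact/ltnW/code_lt.
  exists (iter m T z); split; first by split => //; exists m; left.
  apply: PQB; split => /=.
    apply: n0P; apply: (@agree_le _ n.-1); first by rewrite /n; lia.
    apply: code_fine; rewrite prednK; last by rewrite /n; lia.
    by rewrite -(coherent_code (iter m T z).1 n).2 ck kmod.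
  apply: eQ; rewrite /ball /= -(subrK t' t) -addrA.
  have := kP _ _ ck mF; move: tt'; rewrite ltr_norml !ler_norml => /andP[? ?] /andP[? ?].
  by apply/andP; split; lra.
(* Level [i.+1] is used because its period is a multiple of [p i]. *)
pose pi (z : cantor_space * R) : natseq := fun i => (c i.+1 z.1 %% p i)%N.
exists pi; split.
- apply: continuous_subspaceT => z; apply: (@cvg_coord nat) => i V Vi.
  have [m hm] := code_lc i.+1 z.1.
  have : nbhs z [set z' | agree m z.1 z'.1] by apply: cvg_fst; exact: nbhs_agree.
  apply: filterS => z' /hm E; rewrite /= /pi E; exact: nbhs_singleton Vi.
- apply/seteqP; split => [_ [z zF <-] i|w hw].
    have pi0 : (0 < p i)%N by have [] := podo i.
    rewrite /pi ltn_mod pi0; split => //.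
    rewrite modn_dvdm; last by have [_ []] := podo i.
    by rewrite -(coherent_code z.1 i.+1).2 modn_dvdm // odometer_dvd_period.
  have [y hy] := odometer_lift w hw.
  exists (y, L y); first by rewrite /fence /= lexx fence_le.
  by apply/funext => i; rewrite /pi hy.
- move=> z _; apply/funext => i; rewrite /pi /odometer_map /= hS.
  by rewrite modn_dvdm ?odometer_dvd_period // -addn1 -modnDml addn1.
Qed.

End Limit.

Theorem theorem8p3 (R : realType) (p : nat -> nat) :
  odometer_seq p ->
  forall phiL phiU : cantor_space -> R,
    fraisse_fence phiL phiU ->
    exists T : cantor_space * R -> cantor_space * R,
      minimal_on (fence phiL phiU) T /\
      factor_of (fence phiL phiU) T (odometer_space p) (odometer_map p).
Proof.
move=> podo phiL phiU FF; have [st [st0 stP]] := @stage_sequence R phiL phiU p FF podo.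
exact: limit_system FF podo st0 stP.
Qed.
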